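(* Let $\Phi$ be a crystallographic root system and $\Phi^+\subset\Phi$ a positive system. Then the Helly number of $\Phi^+$ with respect to the closure operator $A \mapsto \mathbb{Z}_{\geq 0}A \cap \Phi^+$ is the maximal size of an abelian set of positive roots (i.e. of an abelian subset of $\Phi^+$).
   Context: A root system $\Phi$ in a finite-dimensional real Euclidean space $V$ with inner product $(\cdot,\cdot)$ is a finite spanning set of nonzero vectors such that for every $\alpha\in\Phi$: $\mathbb{R}\alpha\cap\Phi=\{\alpha,-\alpha\}$, and $s_\alpha(\Phi)=\Phi$, where $s_\alpha(v)=v-\frac{2(v,\alpha)}{(\alpha,\alpha)}\alpha$. It is crystallographic if $2(\beta,\alpha)/(\alpha,\alpha)\in\mathbb{Z}$ for all $\alpha,\beta\in\Phi$. A positive system is a subset of $\Phi$ consisting of the elements that are positive for some total ordering of $V$ compatible with addition and scalar multiplication. $\mathbb{Z}_{\ge0}A$ denotes the set of linear combinations $\sum_{\alpha\in A}c_\alpha\alpha$ with $c_\alpha\in\mathbb{Z}_{\ge0}$. A subset $A\subseteq\Phi$ is abelian if the sum of two roots in $A$ is never a root. Helly number: let $S$ be a closure space with closure operator $\mathrm{cl}$ and $\mathrm{cl}(\varnothing)=\varnothing$. A family $(A_i)_{i\in I}$ of nonempty subsets of $S$ is Helly independent if $\bigcap_J \mathrm{cl}(\bigcup_{j\in J}A_j)=\varnothing$, where $J$ ranges over $I$ and all sets $I\setminus\{i\}$, $i\in I$. The Helly number of $S$ is the maximal size of a finite Helly independent family. *)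

(* Defs.v *)
From mathcomp Require Export all_boot all_order all_algebra finmap.
From mathcomp Require Export mathcomp_extra boolp classical_sets reals.

Set Implicit Arguments.
Unset Strict Implicit.
Unset Printing Implicit Defensive.

Import Order.TTheory GRing.Theory Num.Theory.

Local Open Scope classical_set_scope.
Local Open Scope ring_scope.

Definition is_maximum (E : set nat) (n : nat) : Prop :=
  E n /\ forall m, E m -> (m <= n)%N.

(* A closure space is given by its underlying set S inside an ambient type T;
   cl matters only on subsets of S. *)
Definition closure_operator (T : Type) (S : set T) (cl : set T -> set T) :
    Prop :=
  [/\ forall A, A `<=` S -> A `<=` cl A /\ cl A `<=` S,
      forall A B, A `<=` B -> B `<=` S -> cl A `<=` cl B,
      forall A, A `<=` S -> cl (cl A) = cl A
    & cl set0 = set0].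

(* For empty I the only J is I itself, so the empty family is independent. *)
Definition helly_independent (T : Type) (S : set T) (cl : set T -> set T)
    (I : Type) (A : I -> set T) : Prop :=
  [/\ forall i, A i `<=` S,
      forall i, A i !=set0
    & \bigcap_(J in [set J : set I | J = setT \/ exists i, J = ~` [set i]])
        cl (\bigcup_(j in J) A j) = set0].

Definition is_helly_number (T : Type) (S : set T) (cl : set T -> set T)
    (n : nat) : Prop :=
  is_maximum
    [set m | exists (I : finType) (A : I -> set T),
               helly_independent S cl A /\ #|I| = m] n.

Section RootSystems.
Variables (R : realType) (V : vectType R).

(* A symmetric positive definite bilinear form is a Hermitian one whose
   conjugation idfun is trivial. *)
Definition reflection (dot : {dot V for idfun}) (a v : V) : V :=
  v - (2 * dot v a / dot a a) *: a.

Definition root_system (dot : {dot V for idfun}) (Phi : {fset V}) : Prop :=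
  [/\ <<Phi>>%VS = fullv,
      0 \notin Phi,
      forall a, a \in Phi ->
        range (fun c : R => c *: a) `&` [set` Phi] = [set a; - a]
    & forall a, a \in Phi -> [fset reflection dot a b | b in Phi]%fset = Phi].

Definition crystallographic (dot : {dot V for idfun}) (Phi : {fset V}) :
    Prop :=
  forall a b, a \in Phi -> b \in Phi -> 2 * dot b a / dot a a \is a Num.int.

Definition compatible_total_order (le : rel V) : Prop :=
  [/\ [/\ reflexive le, antisymmetric le, transitive le & total le],
      forall x y z, le x y -> le (x + z) (y + z)
    & forall (c : R) x y, 0 <= c -> le x y -> le (c *: x) (c *: y)].

Definition positive_system (Phi P : {fset V}) : Prop :=
  exists2 le : rel V, compatible_total_order le
    & P = [fset a in Phi | (a != 0) && le 0 a]%fset.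

Definition nonneg_int_span (A : set V) : set V :=
  [set v | exists (s : {fset V}) (c : V -> nat),
             [set` s] `<=` A /\ v = \sum_(a <- s) a *+ c a].

Definition root_closure (P : {fset V}) (A : set V) : set V :=
  nonneg_int_span A `&` [set` P].

Definition abelian_roots (Phi A : {fset V}) : Prop :=
  forall a b, a \in A -> b \in A -> a + b \notin Phi.

Definition is_max_abelian_size (Phi P : {fset V}) (n : nat) : Prop :=
  is_maximum
    [set m | exists A : {fset V},
               [/\ (A `<=` P)%fset, abelian_roots Phi A & #|` A| = m]] n.

Lemma nonneg_int_span_sub (A : set V) : A `<=` nonneg_int_span A.
Proof.
move=> a Aa; exists [fset a]%fset, (fun=> 1%N); split; last by rewrite big_seq_fset1.
by move=> x /=; rewrite inE => /eqP ->.
Qed.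

Lemma nonneg_int_span0 (A : set V) : nonneg_int_span A 0.
Proof. by exists fset0%fset, (fun=> 0%N); split=> //; rewrite big_seq_fset0. Qed.

Lemma nonneg_int_spanD (A : set V) u v :
  nonneg_int_span A u -> nonneg_int_span A v -> nonneg_int_span A (u + v).
Proof.
have ext (s t : {fset V}) (c : V -> nat) : (s `<=` t)%fset ->
    \sum_(a <- s) a *+ c a = \sum_(a <- t) a *+ ((a \in s) * c a)%N.
  move=> st; rewrite [RHS](big_fsetID _ (mem s)) /=.
  have -> : [fset x in t | x \in s]%fset = s.
    apply/fsetP => x; rewrite !inE /=.
    by case xs: (x \in s); rewrite ?andbF // (fsubsetP st x xs).
  rewrite [X in _ = _ + X]big_seq [X in _ = _ + X]big1 => [|x].
    by rewrite addr0; apply: eq_big_seq => x ->; rewrite mul1n.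
  by rewrite !inE /= => /andP[_ /negbTE ->]; rewrite mul0n mulr0n.
move=> [s [c [sA ->]]] [t [d [tA ->]]].
exists (s `|` t)%fset, (fun a => (a \in s) * c a + (a \in t) * d a)%N; split.
  by move=> x /=; rewrite inE => /orP[/sA|/tA].
rewrite (ext s _ _ (fsubsetUl s t)) (ext t _ _ (fsubsetUr s t)) -big_split /=.
by apply: eq_bigr => x _; rewrite mulrnDr.
Qed.

Lemma nonneg_int_span_min (A B : set V) :
  A `<=` nonneg_int_span B -> nonneg_int_span A `<=` nonneg_int_span B.
Proof.
move=> AB _ [s [c [sA ->]]]; rewrite big_seq.
apply: (big_ind (nonneg_int_span B)); first exact: nonneg_int_span0.
  by move=> u v; apply: nonneg_int_spanD.
move=> x /sA/AB Bx; elim: (c x) => [|n IH]; first exact: nonneg_int_span0.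
by rewrite mulrS; apply: nonneg_int_spanD.
Qed.

Lemma root_closure_operator (P : {fset V}) :
  0 \notin P -> closure_operator [set` P] (root_closure P).
Proof.
move=> P0; split.
- move=> A AP; split; last by move=> x [].
  by move=> x Ax; split; [exact: nonneg_int_span_sub | exact: AP].
- move=> A B AB _ x [Ax Px]; split=> //; apply: nonneg_int_span_min Ax.
  exact: subset_trans AB (@nonneg_int_span_sub _).
- move=> A AP; apply/seteqP; split=> x [Ax Px]; split=> //.
    by apply: nonneg_int_span_min Ax => y [].
  by apply: nonneg_int_span_sub.
apply/seteqP; split=> // x [[s [c [s0 xE]]] Px]; case/negP: P0.
suff <- : x = 0 by [].
by rewrite xE big_seq big1 // => y /s0.
Qed.

End RootSystems.

(* Main.v *)
(** An abelian set [A] of positive roots is free for this closure: its elements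
    have pairwise nonnegative inner products, so if a root [b] is a sum of at
    least two of them, then [b] has positive inner product with each summand
    [a], and unless [b = a] the difference [b - a] is a root which is a shorter
    sum, hence in [A] by induction, and [b = a + (b - a)] contradicts
    abelianity.  So the singletons of [A] are Helly independent.

    Conversely, let [A i] be a Helly independent family and [C i] the closure of
    the union of the [A j], [j <> i].  The [C i] have no common point, but any
    proper subfamily has one.  Adding to a closed set [C i] the greatest
    positive root [p i] outside it yields a closed set, and if [p i] is missed
    by some other [C j], this keeps the intersection empty.  When no further
    enlargement is possible, [p i] lies in all [C j] with [j <> i]; the
    intersection of the closed sets [C i + p i] is then exactly the set of the
    [p i], and this set is abelian. *)

Require Import Defs.
From mathcomp Require Import sesquilinear lra.

Set Implicit Arguments.
Unset Strict Implicit.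

Import Order.TTheory GRing.Theory Num.Theory.

Local Open Scope classical_set_scope.
Local Open Scope ring_scope.

(** * Sums and differences of crystallographic roots *)

Section CrystallographicRoots.
Variables (R : realType) (V : vectType R) (dot : {dot V for idfun}).
Variable Phi : {fset V}.
Hypotheses (hPhi : root_system dot Phi) (hcryst : crystallographic dot Phi).

Lemma dotC u v : dot u v = dot v u.
Proof. by rewrite hermC /= expr0 mul1r. Qed.

Lemma root_dot_gt0 a : a \in Phi -> 0 < dot a a.
Proof.
case: hPhi => _ Phi0 _ _ aPhi; apply: neq0_dnorm_gt0.
by apply: contraNneq Phi0 => <-.
Qed.

Lemma root_reflection a b :
  a \in Phi -> b \in Phi -> reflection dot a b \in Phi.
Proof.
by case: hPhi => _ _ _ refl aPhi bPhi; rewrite -(refl a aPhi) in_imfset.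
Qed.

Lemma rootN a : a \in Phi -> - a \in Phi.
Proof.
move=> aPhi; have := root_reflection aPhi aPhi.
rewrite /reflection mulfK ?gt_eqF ?root_dot_gt0 //.
by rewrite scaler_nat mulr2n opprD addNKr.
Qed.

(** If one of the integers [2(a,b)/(b,b)] and [2(a,b)/(a,a)] is 1, a reflection gives [a - b] up to
    sign. If both are at least 2, then [(a,b)] bounds [(a,a)] and [(b,b)], so [(a - b, a - b) <= 0],
    which is absurd. *)
Lemma root_subr a b :
  a \in Phi -> b \in Phi -> a != b -> 0 < dot a b -> a - b \in Phi.
Proof.
move=> aPhi bPhi ab dab.
have key x y : x \in Phi -> y \in Phi -> 0 < dot y x ->
    y - x \in Phi \/ dot x x <= dot y x.
  move=> xPhi yPhi dyx; have dxx := root_dot_gt0 xPhi.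
  have /intrP[m mE] := hcryst xPhi yPhi.
  have := root_reflection xPhi yPhi; rewrite /reflection mE.
  have : 0 < m%:~R :> R by rewrite -mE divr_gt0 ?mulr_gt0.
  rewrite ltr0z gtz0_ge1 le_eqVlt => /predU1P[<-|].
    by rewrite scale1r; left.
  rewrite -lez1D => m2 _; right.
  have : 2 <= m%:~R :> R by rewrite -[2]/((2 : int)%:~R) ler_int.
  by rewrite -mE ler_pdivlMr // ler_pM2l.
have [//|bb] := key b a bPhi aPhi dab.
have dba : 0 < dot b a by rewrite dotC.
have [/rootN|aa] := key a b aPhi bPhi dba; first by rewrite opprB.
have : 0 < dot (a - b) (a - b) by apply: neq0_dnorm_gt0; rewrite subr_eq0.
rewrite linearBl /= !linearBr /= (dotC b a); move: aa; rewrite (dotC b a).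
lra.
Qed.

Lemma root_addr a b :
  a \in Phi -> b \in Phi -> a != - b -> dot a b < 0 -> a + b \in Phi.
Proof.
move=> aPhi /rootN bPhi ab dab; rewrite -[b]opprK root_subr //.
by rewrite linearNr oppr_gt0.
Qed.

End CrystallographicRoots.

(** * Nonnegative integer combinations as sums of sequences *)

Section NonnegIntSpan.
Variables (R : realType) (V : vectType R).
Implicit Types (A : set V) (s : seq V).

Lemma nonneg_int_span_sum A s :
  {in s, forall x, A x} -> nonneg_int_span A (\sum_(x <- s) x).
Proof.
move=> sA; rewrite big_seq; apply: big_ind => [|u v|x xs].
- exact: nonneg_int_span0.
- exact: nonneg_int_spanD.
- exact/nonneg_int_span_sub/sA.
Qed.

(** Coefficients become repetitions, so that summands can be removed one at a time. *)
Lemma nonneg_int_span_seq A v : nonneg_int_span A v ->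
  exists2 s, {in s, forall x, A x} & v = \sum_(x <- s) x.
Proof.
case=> s [c [sA ->]]; exists (flatten [seq nseq (c a) a | a <- s]).
  by move=> x /flatten_mapP[a /sA Aa]; rewrite mem_nseq => /andP[_ /eqP ->].
rewrite big_flatten big_map; apply: eq_bigr => a _.
by rewrite big_nseq iter_addr addr0.
Qed.

End NonnegIntSpan.

(** * Positive roots, and abelian sets as Helly independent families *)

Section PositiveSystem.
Variables (R : realType) (V : vectType R) (dot : {dot V for idfun}).
Variables (Phi P : {fset V}) (le : rel V).
Hypotheses (hPhi : root_system dot Phi) (hcryst : crystallographic dot Phi).
Hypothesis hle : compatible_total_order le.
Hypothesis PE : P = [fset a in Phi | (a != 0) && le 0 a]%fset.

Lemma posrootE a : (a \in P) = [&& a \in Phi, a != 0 & le 0 a].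
Proof. by rewrite PE !inE. Qed.

Lemma posroot_root a : a \in P -> a \in Phi.
Proof. by rewrite posrootE => /andP[]. Qed.

Lemma le_add u v x y : le u x -> le v y -> le (u + v) (x + y).
Proof.
case: hle => [[_ _ letr _] leD _] ux vy; apply: (letr (x + v)); first exact: leD.
by rewrite ![x + _]addrC leD.
Qed.

Lemma le0_sum (s : seq V) : {subset s <= P} -> le 0 (\sum_(x <- s) x).
Proof.
case: hle => [[lerefl _ _ _] _ _] sP; rewrite big_seq.
apply: (big_ind (le 0)) => // [u v u0 v0|x /sP]; last by rewrite posrootE => /and3P[].
by have := le_add u0 v0; rewrite addr0.
Qed.

Lemma posrootD a b : a \in P -> b \in P -> a + b \in Phi -> a + b \in P.
Proof.
move=> aP bP abPhi; rewrite posrootE abPhi /=; apply/andP; split.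
  by case: hPhi => _ Phi0 _ _; apply: contraNneq Phi0 => <-.
have := @le0_sum [:: a; b]; rewrite !big_cons big_nil addr0; apply.
by move=> x; rewrite !inE => /orP[] /eqP ->.
Qed.

Lemma posroot_oppF a b : a \in P -> b \in P -> a != - b.
Proof.
case: hle => [[_ leanti _ _] leD _].
rewrite !posrootE => /and3P[_ _ a0] /and3P[_ b0 b_ge0].
apply: contra_neq b0 => aE; apply: leanti; rewrite b_ge0 andbT.
by have := leD _ _ b a0; rewrite aE addNr add0r.
Qed.

Lemma abelian_dot_ge0 (A : {fset V}) a b : (A `<=` P)%fset ->
  abelian_roots Phi A -> a \in A -> b \in A -> 0 <= dot a b.
Proof.
move=> /fsubsetP AP abA aA bA; rewrite leNgt; apply: contra (abA a b aA bA).
by apply: (root_addr hPhi hcryst); rewrite ?posroot_oppF ?posroot_root ?AP.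
Qed.

Lemma abelian_sum (A : {fset V}) (s : seq V) : (A `<=` P)%fset ->
  abelian_roots Phi A -> {subset s <= A} -> \sum_(x <- s) x \in Phi ->
  \sum_(x <- s) x \in A.
Proof.
move=> AP abA; elim: s => [|a s IH] sA.
  by case: hPhi => _ Phi0 _ _; rewrite big_nil (negPf Phi0).
have aA : a \in A by apply: sA; rewrite inE eqxx.
have aPhi : a \in Phi by rewrite posroot_root ?(fsubsetP AP).
have sA' : {subset s <= A} by move=> x xs; apply: sA; rewrite inE xs orbT.
rewrite big_cons; set b := \sum_(x <- s) x => bPhi.
(* A tail summing to zero is set apart, since [root_subr] needs distinct roots; this includes the
   sequence with one element. *)
have [->//|ab] := eqVneq (a + b) a.
have ab_gt0 : 0 < dot (a + b) a.
  rewrite linearDl /= ltr_wpDr ?(root_dot_gt0 hPhi) // /b dotC linear_sum.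
  rewrite big_seq sumr_ge0 // => x xs.
  by apply: (abelian_dot_ge0 AP abA) => //; apply: sA'.
have := root_subr hPhi hcryst bPhi aPhi ab ab_gt0.
rewrite addrC addKr => /(IH sA') bA.
by have := abA _ _ aA bA; rewrite bPhi.
Qed.

Lemma abelian_closed (A : {fset V}) : (A `<=` P)%fset -> abelian_roots Phi A ->
  root_closure P [set` A] `<=` [set` A].
Proof.
move=> AP abA _ [/nonneg_int_span_seq[s sA ->] /= /posroot_root].
exact: abelian_sum.
Qed.

Lemma abelian_helly (A : {fset V}) : (A `<=` P)%fset -> abelian_roots Phi A ->
  helly_independent [set` P] (root_closure P) (fun a : A => [set val a]).
Proof.
move=> AP abA; split=> [a _ ->|a|]; first exact: (fsubsetP AP) (valP a).
  by exists (val a).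
have sub_cl (J : set A) : \bigcup_(j in J) [set val j] `<=` [set` A].
  by move=> _ [a _ ->]; exact: valP a.
apply/seteqP; split=> // x xcl.
have xA : x \in A.
  have [|xspan xP] := xcl setT; first by left.
  apply: (abelian_closed AP abA); split=> //.
  by apply: nonneg_int_span_min xspan; apply: subset_trans (@nonneg_int_span_sub _ _ _).
have [|xspan xP] := xcl (~` [set [` xA]%fset]); first by right; exists [` xA]%fset.
(* [A] without [x] is again abelian, hence closed, and it contains all the other singletons. *)
suff : x \in (A `\ x)%fset by rewrite !inE eqxx.
apply: abelian_closed; last split=> //.
- exact: fsubset_trans (fsubD1set _ _) AP.
- by move=> a b; rewrite !inE => /andP[_ aA] /andP[_ bA]; apply: abA.
apply: nonneg_int_span_min xspan => _ [a ax ->]; apply: nonneg_int_span_sub.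
rewrite /= !inE (valP a) andbT; apply/negP => /eqP aE; apply: ax.
exact/val_inj.
Qed.

(** * From Helly independent families to abelian sets *)

Definition closed_roots (C : {fset V}) : Prop :=
  root_closure P [set` C] `<=` [set` C].

Lemma ex_greatest (B : {fset V}) : B != fset0 ->
  exists2 p, p \in B & {in B, forall x, le x p}.
Proof.
case: hle => [[lerefl _ letr letot] _ _].
elim/finSet_rect: B => B IH /fset0Pn[x xB].
have [B0|/(IH _ (fproperD1 xB))[p]] := eqVneq (B `\ x)%fset fset0.
  exists x => // y yB; have [->//|yx] := eqVneq y x.
  by have : y \in (B `\ x)%fset; [rewrite !inE yx | rewrite B0].
rewrite !inE => /andP[_ pB] pmax.
have [xp|px] := orP (letot x p).
  by exists p => // y yB; have [->//|yx] := eqVneq y x; rewrite pmax // !inE yx.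
exists x => // y yB; have [->//|yx] := eqVneq y x.
by apply: letr px; rewrite pmax // !inE yx.
Qed.

(* A root generated by [C] and [p] using [p] at least once is [p] or exceeds it. *)
Lemma closed_add_greatest (C : {fset V}) p : (C `<=` P)%fset ->
  closed_roots C -> p \in P -> {in (P `\` C)%fset, forall x, le x p} ->
  closed_roots (p |` C)%fset.
Proof.
case: hle => [[_ leanti _ _] leD _].
move=> /fsubsetP CP clC pP pmax v [/nonneg_int_span_seq[s sC vE] /= vP].
rewrite !inE orbC; have [//|vC] := boolP (v \in C).
have [/perm_to_rem ps|ps] := boolP (p \in s); last first.
  case/negP: vC; apply: clC; split=> //; rewrite vE.
  apply: nonneg_int_span_sum => x xs; have /= := sC x xs.
  by rewrite !inE => /predU1P[xp|//]; rewrite -xp xs in ps.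
(* Since [v] lies outside [C], maximality gives [le v p]; removing one [p] from the sum gives
   [le p v]. *)
apply/eqP/leanti; rewrite pmax ?inE ?vC //=.
rewrite vE (perm_big _ ps) big_cons /= addrC -{1}[p]add0r leD // le0_sum //.
by move=> x /mem_rem/sC /=; rewrite !inE => /predU1P[->//|/CP].
Qed.

(** Induction on the total number of positive roots missed by the sets [C i], which every
    enlargement lowers. *)
Lemma critical_family_abelian (I : finType) (C : I -> {fset V}) :
  (forall i, (C i `<=` P)%fset) -> (forall i, closed_roots (C i)) ->
  (forall x, x \in P -> exists i, x \notin C i) ->
  (forall k, exists2 x, x \in P & forall i, i != k -> x \in C i) ->
  exists A : {fset V}, [/\ (A `<=` P)%fset, abelian_roots Phi A & #|` A| = #|I|].
Proof.
have [n] := ubnP (\sum_i #|` (P `\` C i)%fset|).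
elim: n C => // n IH C nC CP clC C0 Cne.
have /choice[p pP] k : exists p, [/\ p \in P, p \notin C k
    & {in (P `\` C k)%fset, forall x, le x p}].
  have [|p] := @ex_greatest (P `\` C k)%fset.
    (* A common point of the other sets must be missed by [C k]. *)
    have [x xP xC] := Cne k; apply/fset0Pn; exists x; rewrite !inE xP andbT.
    have [i] := C0 x xP; apply: contra => xk.
    by have [->//|/xC] := eqVneq i k.
  by rewrite !inE => /andP[pC pP] pmax; exists p.
have [/existsP[k /existsP[j /andP[jk pj]]]|] :=
    boolP [exists k, exists j, (j != k) && (p k \notin C j)].
  have [pkP pkC pmax] := pP k.
  pose D i := if i == k then (p k |` C k)%fset else C i.
  have CD i : (C i `<=` D i)%fset.
    by rewrite /D; case: eqP => [->|]; rewrite ?fsubsetU1.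
  apply: (IH D).
  - rewrite -ltnS; apply: leq_trans nC; rewrite ltnS (bigD1 k) //= [ltnRHS](bigD1 k) //=.
    rewrite -addSn leq_add //.
      apply: fproper_ltn_card; rewrite fproperEneq fsetDS // andbT.
      apply/eqP => /fsetP/(_ (p k)).
      by rewrite !inE /D eqxx pkP pkC !inE eqxx.
    by apply: leq_sum => i _; apply/fsubset_leq_card/fsetDS.
  - move=> i; rewrite /D; case: eqP => // _.
    by rewrite fsubUset fsub1set pkP CP.
  - by move=> i; rewrite /D; case: eqP => // _; apply: closed_add_greatest.
  - move=> x xP; have [i xi] := C0 x xP; have [ik|ik] := eqVneq i k.
      have [->|xp] := eqVneq x (p k); first by exists j; rewrite /D (negPf jk).
      by exists k; rewrite /D eqxx !inE negb_or xp -ik.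
    by exists i; rewrite /D (negPf ik).
  - move=> i; have [x xP xC] := Cne i; exists x => // l li.
    exact/(fsubsetP (CD l))/xC.
rewrite negb_exists => /forallP pC.
have {}pC k j : j != k -> p k \in C j.
  move=> jk; have := pC k; rewrite negb_exists => /forallP/(_ j).
  by rewrite jk negbK.
have p_inj : injective p.
  move=> i j pij; apply/eqP; have [_ piC _] := pP i.
  by apply: contraNT piC => /pC; rewrite -pij.
exists [fset p i | i : I]%fset; split.
- by apply/fsubsetP => _ /imfsetP[i _ ->]; case: (pP i).
- move=> _ _ /imfsetP[/= i _ ->] /imfsetP[/= j _ ->]; apply/negP => ijPhi.
  have [piP _ _] := pP i; have [pjP _ _] := pP j.
  have ijP := posrootD piP pjP ijPhi.
  have p_neq0 l : p l != 0.
    by have [+ _ _] := pP l; rewrite posrootE => /and3P[].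
  have add_cl (D : {fset V}) : closed_roots D -> p i \in D -> p j \in D ->
      p i + p j \in D.
    move=> clD iD jD; apply: clD; split=> //.
    by apply: nonneg_int_spanD; apply: nonneg_int_span_sub.
  (* Some [C k] misses [p i + p j], but the closed set [C k] with [p k] added contains every [p l],
     so the sum is [p k]. As roots are nonzero, [k] differs from [i] and [j], so [C k] contains both
     summands and hence their sum. *)
  have [k kij] := C0 _ ijP; have [pkP pkC pmax] := pP k.
  have pD l : p l \in (p k |` C k)%fset.
    by rewrite !inE; have [->|kl] := eqVneq k l; rewrite ?eqxx ?(pC _ _ kl) ?orbT.
  have := add_cl _ (closed_add_greatest (CP k) (clC k) pkP pmax) (pD i) (pD j).
  rewrite !inE (negPf kij) orbF => /eqP ijk.
  case/negP: kij; apply: add_cl => //; apply: pC; apply/eqP => kE.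
    by case/negP: (p_neq0 j); rewrite -(inj_eq (addrI (p i))) ijk addr0 kE.
  by case/negP: (p_neq0 i); rewrite -(inj_eq (addIr (p j))) ijk add0r kE.
- by rewrite card_imfset //= cardE enumT.
Qed.

Lemma helly_abelian (I : finType) (F : I -> set V) :
  helly_independent [set` P] (root_closure P) F ->
  exists A : {fset V}, [/\ (A `<=` P)%fset, abelian_roots Phi A & #|` A| = #|I|].
Proof.
move=> [FP Fne F0].
(* An index [i0] serves for [J = setT]: the closure of the whole union contains that of [U i0]. *)
have [I0|/card_gt0P[i0 _]] := posnP #|I|.
  by exists fset0; split; rewrite ?fsub0set ?cardfs0 ?I0.
pose U k := \bigcup_(j in ~` [set k]) F j.
pose C k := [fset x in P | `[< root_closure P (U k) x >]]%fset.
have P0 : 0 \notin P by rewrite posrootE eqxx andbF.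
have [_ cl_mono cl_idem _] := root_closure_operator P0.
have UP k : U k `<=` [set` P] by move=> x [j _ /FP].
have CE k : [set` C k] = root_closure P (U k).
  apply/seteqP; split=> x /=; rewrite !inE /=; first by case/andP=> _ /asboolP.
  by move=> xU; rewrite asboolT //; case: xU => _ ->.
apply: (@critical_family_abelian I C) => [i|i|x xP|k].
- exact: fset_sub.
- by rewrite /closed_roots CE cl_idem.
- apply: contrapT => /forallNP xC; suff : set0 x by [].
  rewrite -F0 => J Jspec.
  have xU i : root_closure P (U i) x.
    by rewrite -CE /=; apply/negPn/negP; apply: xC.
  case: Jspec => [->|[i ->]]; last exact: xU.
  by apply: cl_mono (xU i0) => [y [j _ Fj]|y [j _ /FP//]]; exists j.
- have [x Fx] := Fne k; exists x; first exact: FP Fx.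
  move=> i ik; suff : [set` C i] x by [].
  rewrite CE; split; last exact: FP Fx.
  by apply: nonneg_int_span_sub; exists k => //= ki; rewrite ki eqxx in ik.
Qed.

End PositiveSystem.

Theorem proposition1p5 (R : realType) (V : vectType R)
    (dot : {dot V for idfun}) (Phi PhiP : {fset V})
    (hPhi : root_system dot Phi) (hcryst : crystallographic dot Phi)
    (hpos : positive_system Phi PhiP) :
  exists n : nat,
    is_helly_number [set` PhiP] (root_closure PhiP) n /\
    is_max_abelian_size Phi PhiP n.
Proof.
have [le hle PE] := hpos.
pose E n := exists A : {fset V},
  [/\ (A `<=` PhiP)%fset, abelian_roots Phi A & #|` A| = n].
have exE : exists n, `[< E n >].
  by exists 0%N; apply/asboolP; exists fset0; split; rewrite ?fsub0set ?cardfs0.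
(* This bound makes the maximal abelian size exist; the two constructions then show that it is the
   Helly number. *)
have leE n : `[< E n >] -> (n <= #|` PhiP|)%N.
  by move=> /asboolP[A [/fsubset_leq_card AP _ <-]].
have [n /asboolP En maxn] := ex_maxnP exE leE.
exists n; split; last by split=> // m Em; apply/maxn/asboolP.
split=> [|m [I [F [hF <-]]]].
  have [A [AP abA <-]] := En; exists A, (fun a : A => [set val a]).
  by split; [exact: (abelian_helly hPhi hcryst hle PE AP abA) | rewrite cardfE].
by apply/maxn/asboolP; exact: (helly_abelian hPhi hle PE hF).
Qed.
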